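(* Let $(X,\|\cdot\|)$ be a smooth normed space and let $\mathrm{cm}:X_o\times X_o\to\mathbb{R}$ be its cosine function. If $\mathrm{cm}$ is symmetric, i.e. $\mathrm{cm}(x,y)=\mathrm{cm}(y,x)$ for all $x,y\in X_o$, then the norm $\|\cdot\|$ is Euclidean, i.e. it is derived from an inner product on $X$.
   Context: A normed (Minkowski) space is a finite dimensional real vector space $X$ endowed with a norm $\|\cdot\|$; $X_o=X\setminus\{o\}$, where $o$ is the origin. The space is smooth if the unit ball has exactly one supporting hyperplane at each point of the unit sphere. For $x\in X_o$ let $f_x\in X^*$ be the (up to multiplication by a positive scalar unique) nonzero linear functional attaining its norm at $x/\|x\|$, i.e. $f_x(x)=\|f_x\|_*\|x\|$, where $\|\cdot\|_*$ is the dual norm. The cosine function of a smooth normed space is $\mathrm{cm}(x,y)=\dfrac{f_x(y)}{\|f_x\|_*\,\|y\|}$ for $x,y\in X_o$. *)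

(* Defs.v *)
From HB Require Import structures.
From mathcomp Require Import all_boot all_order all_algebra.
From mathcomp Require Import boolp classical_sets reals topology normedtype.
Set Implicit Arguments.
Unset Strict Implicit.
Unset Printing Implicit Defensive.
Import Order.TTheory GRing.Theory Num.Theory.
Import numFieldNormedType.Exports.
Local Open Scope classical_set_scope.
Local Open Scope ring_scope.

(** A Minkowski space is a finite dimensional real vector space endowed with a
    norm: the library has [vectType R] (finite dimension) and [normedModType R]
    (norm), but not their join. *)
#[short(type="minkowskiType")]
HB.structure Definition MinkowskiSpace (R : realType) :=
  {X of NormedModule R X & Vector R X}.

Section MinkowskiGeometry.
Variables (R : realType) (X : minkowskiType R).
Implicit Types (x y : X) (K H : set X) (f : 'Hom(X, R^o)).

Definition unit_ball : set X := [set y | `|y| <= 1].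

(** Replacing [(f, c)] by [(- f, - c)] leaves [H] unchanged and swaps its two
    closed half-spaces, so "K lies on one side of H" may be written with [<=]. *)
Definition supporting_hyperplane K x H :=
  exists f (c : R), [/\ f != 0, H = [set y | f y = c], H x &
    K `<=` [set y | f y <= c]].

Definition smooth :=
  forall x, `|x| = 1 -> exists! H, supporting_hyperplane unit_ball x H.

Definition dual_norm f : R := sup [set `|f y| | y in unit_ball].

Definition attains_norm_at x f := f != 0 /\ f x = dual_norm f * `|x|.

(** The functional f_x, only determined up to a positive factor: a
    representative is chosen, on which [cm] below does not depend. The value [0]
    is a dummy default, used when no nonzero functional attains its norm
    at [x]. *)
Definition support_functional x : 'Hom(X, R^o) :=
  xget 0 [set f | attains_norm_at x f].

(** Total function; only meaningful for nonzero [x] and [y]. *)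
Definition cm x y : R :=
  support_functional x y / (dual_norm (support_functional x) * `|y|).

(** [{dot X for idfun}] is the type of symmetric positive definite bilinear
    forms on [X]. *)
Definition euclidean :=
  exists ip : {dot X for (@idfun R)}, forall x, `|x| = Num.sqrt (ip x x).

End MinkowskiGeometry.

Arguments unit_ball {R} X.
Arguments smooth {R} X.
Arguments euclidean {R} X.

(* Main.v *)
(** On a smooth space [g x y := |x| |y| cm x y] equals [(|x| / ||f_x||) f_x y],
    which is linear in [y], and [g x x = |x|^2]. If [cm] is symmetric then so is
    [g], which is therefore bilinear, hence an inner product inducing the norm. *)
From HB Require Import structures.
Require Import Defs.
From mathcomp Require Import all_boot all_order all_algebra.
From mathcomp Require Import classical_sets reals normedtype.
Set Implicit Arguments.
Unset Strict Implicit.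
Unset Printing Implicit Defensive.
Import Order.TTheory GRing.Theory Num.Theory.
Local Open Scope ring_scope.

Section Minkowski.
Context {R : realType} {X : minkowskiType R}.
Implicit Types (x y : X) (f : 'Hom(X, R^o)).

(** The functional defines a hyperplane supporting the ball at [x] normalised, and [c] is its level.
    The ball is symmetric about the origin, so the one-sided bound by [c] is two-sided. *)
Lemma smooth_attaining x :
  smooth X -> x != 0 ->
  exists f (c : R), [/\ f x != 0, forall y, `|f y| <= c * `|y| & f x = c * `|x|].
Proof.
move=> smX x0; have nx0 : `|x| != 0 by rewrite normr_eq0.
have n1 : `|(`|x|^-1 *: x)| = 1.
  by rewrite normrZ normfV normr_id mulVf.
have [H [[f [c [f0 -> /= fxc le_c]]] _]] := smX _ n1.
have le_fc y : `|f y| <= c * `|y|.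
  have [->|y0] := eqVneq y 0; first by rewrite linear0 !normr0 mulr0.
  have ny0 : 0 < `|y| by rewrite normr_gt0.
  have ny1 : `|(`|y|^-1 *: y)| = 1.
    by rewrite normrZ normfV normr_id mulVf ?gt_eqF.
  have A1 : f (`|y|^-1 *: y) <= c by apply: le_c; rewrite /unit_ball /= ny1.
  have A2 : f (- (`|y|^-1 *: y)) <= c.
    by apply: le_c; rewrite /unit_ball /= normrN ny1.
  rewrite -ler_pdivrMr // mulrC -[X in X * _]gtr0_norm ?invr_gt0 // -normrM.
  rewrite -[_ * _]/(_ *: f y) -linearZ ler_norml A1 andbT lerNl -linearN.
  exact: A2.
have fx : f x = c * `|x|.
  by rewrite -fxc linearZ /= mulrC mulVKf.
exists f, c; split => //; rewrite fx mulf_eq0 (negbTE nx0) orbF.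
(* If [c = 0], the bound forces [f] to vanish identically. *)
apply: contra f0 => /eqP c0; apply/eqP/lfunP => y; rewrite lfunE /=.
by apply/eqP; rewrite -normr_le0; have := le_fc y; rewrite c0 mul0r.
Qed.

(* Boundedness holds on every finite dimensional space; smoothness provides
   bounded functionals that separate points, so that a descent from [U] to the
   kernel in [U] of such a functional replaces the usual compactness argument. *)
Lemma smooth_bounded f :
  smooth X -> exists C, forall x, `|f x| <= C * `|x|.
Proof.
move=> smX.
suff: forall n (U : {vspace X}), (\dim U < n)%N ->
    exists C, forall x, x \in U -> `|f x| <= C * `|x|.
  move=> /(_ _ fullv (ltnSn _)) [C HC].
  by exists C => x; apply: HC; rewrite memvf.
elim=> // n IHn U; rewrite ltnS => dimU.
have [->|U0] := eqVneq U 0%VS.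
  by exists 0 => x; rewrite memv0 => /eqP->; rewrite linear0 !normr0 mulr0.
have u0 : vpick U != 0 by rewrite vpick0.
have [h [c [hu0 le_hc _]]] := smooth_attaining smX u0.
have uU := memv_pick U; move: (vpick U) u0 hu0 uU => u u0 hu0 uU.
have [|C HC] := IHn (U :&: lker h)%VS.
  apply: leq_trans dimU; rewrite (ltn_leqif (dimv_leqif_eq (capvSl _ _))).
  by apply: contra hu0 => /eqP eqU; move: uU; rewrite -eqU memv_cap memv_ker => /andP[].
(* Split [x] as [a *: u] plus a vector of the kernel of [h]. Then [d] bounds [a] relative to the
   norm of [x], and [1 + d * |u|] bounds the kernel part. The absolute value of [C] is taken because
   [C] may be negative when the kernel in [U] is trivial. *)
pose d := `|h u|^-1 * c.
exists (d * `|f u| + `|C| * (1 + d * `|u|)) => x xU.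
pose a : R := (h u)^-1 * h x.
have le_a : `|a| <= d * `|x|.
  by rewrite normrM normfV -mulrA ler_wpM2l ?invr_ge0.
have x'U : x - a *: u \in (U :&: lker h)%VS.
  rewrite memv_cap memvB ?memvZ // memv_ker linearB linearZ /=.
  by rewrite /a -[_ *: _]/(_ * _) mulrAC mulVf // mul1r subrr.
have -> : f x = a * f u + f (x - a *: u).
  by rewrite -[_ * _]/(_ *: f u) -linearZ -linearD addrC subrK.
rewrite mulrDl; apply: le_trans (ler_normD _ _) _; apply: lerD.
  by rewrite normrM mulrAC ler_wpM2r.
apply: le_trans (HC _ x'U) _; rewrite -mulrA.
apply: le_trans (ler_wpM2r (normr_ge0 _) (ler_norm C)) _.
apply: ler_wpM2l => //; apply: le_trans (ler_normB _ _) _.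
by rewrite mulrDl mul1r lerD2l normrZ mulrAC ler_wpM2r.
Qed.

(* The hypothesis excludes the junk value [0] of the supremum of an unbounded
   set. *)
Lemma le_dual_norm f C x :
  (forall y, `|f y| <= C * `|y|) -> `|f x| <= dual_norm f * `|x|.
Proof.
move=> leC; have [->|x0] := eqVneq x 0.
  by rewrite linear0 !normr0 mulr0.
have nx0 : 0 < `|x| by rewrite normr_gt0.
rewrite mulrC -ler_pdivrMl // -[X in X * _](ger0_norm (ltW _)) ?invr_gt0 //.
rewrite -normrM -[_ * _]/(_ *: f x) -linearZ /=; apply: ub_le_sup.
  exists `|C| => _ [y /= y1 <-]; apply: le_trans (leC y) _.
  apply: le_trans (ler_wpM2r (normr_ge0 _) (ler_norm C)) _.
  by rewrite ler_piMr.
exists (`|x|^-1 *: x) => //.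
by rewrite /unit_ball /= normrZ normfV normr_id mulVf ?gt_eqF.
Qed.

(** Since [f] is bounded, [dual_norm f] is a genuine supremum, and [f] would vanish if it were
    nonpositive. *)
Lemma dual_norm_gt0 f : smooth X -> f != 0 -> 0 < dual_norm f.
Proof.
move=> smX f0; have [C leC] := smooth_bounded f smX.
rewrite ltNge; apply: contra f0 => d0; apply/eqP/lfunP => x; rewrite lfunE /=.
apply/eqP; rewrite -normr_le0; apply: le_trans (le_dual_norm x leC) _.
by rewrite mulr_le0_ge0.
Qed.

(** The level [c] of [smooth_attaining] is the dual norm: it bounds [f] on the ball and is reached
    in the direction of [x]. So the choice in [support_functional] never falls back on its
    default. *)
Lemma smooth_attains x :
  smooth X -> x != 0 -> attains_norm_at x (support_functional x).
Proof.
move=> smX x0; apply: xgetPex; have [f [c [fx0 le_c fxc]]] := smooth_attaining smX x0.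
exists f; split; first by apply: contra fx0 => /eqP->; rewrite lfunE.
have nx0 : 0 < `|x| by rewrite normr_gt0.
apply/eqP; rewrite eq_le (le_trans (ler_norm _) (le_dual_norm x le_c)) /=.
rewrite fxc ler_wpM2r //; apply: ge_sup.
  by exists `|f 0|, 0 => //; rewrite /unit_ball /= normr0.
have c0 : 0 <= c by rewrite -(pmulr_lge0 _ nx0); exact: le_trans (le_c x).
by move=> _ [y /= y1 <-]; apply: le_trans (le_c y) _; rewrite ler_piMr.
Qed.

(** This is the [g] of the overview; the norm factors make it zero where [cm] has no meaning. *)
Definition cm_form x y : R := `|x| * `|y| * cm x y.

Lemma cm_formE x y :
  cm_form x y = `|x| / dual_norm (support_functional x) * support_functional x y.
Proof.
rewrite /cm_form /cm; have [->|y0] := eqVneq y 0.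
  by rewrite linear0 normr0 mulr0 mul0r mulr0.
rewrite invfM -!mulrA; congr (_ * _).
by rewrite mulrC -!mulrA mulVf ?normr_eq0 // mulr1 mulrC.
Qed.

Lemma cm_formxx x : smooth X -> cm_form x x = `|x| ^+ 2.
Proof.
move=> smX; have [->|x0] := eqVneq x 0.
  by rewrite /cm_form normr0 !mul0r expr0n.
have [f0 fx] := smooth_attains smX x0.
rewrite cm_formE fx mulrA mulfVK ?expr2 // gt_eqF //.
exact: dual_norm_gt0.
Qed.

Lemma cm_form_linear x : linear_for *%R (cm_form x).
Proof.
by move=> a y z; rewrite !cm_formE linearP /= mulrDr; congr (_ + _); rewrite mulrCA.
Qed.

Lemma cm_formC x y :
  (forall x y, x != 0 -> y != 0 -> cm x y = cm y x) -> cm_form x y = cm_form y x.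
Proof.
move=> cmC; rewrite /cm_form [`|y| * _]mulrC.
have [->|x0] := eqVneq x 0; first by rewrite normr0 !mul0r.
have [->|y0] := eqVneq y 0; first by rewrite normr0 mulr0 !mul0r.
by rewrite cmC.
Qed.

End Minkowski.

Theorem proposition2p3p1 (R : realType) (X : minkowskiType R) :
  smooth X ->
  (forall x y : X, x != 0 -> y != 0 -> cm x y = cm y x) ->
  euclidean X.
Proof.
move=> smX cmC.
pose g : X -> X -> R := cm_form.
have gC x y : g x y = g y x by exact: cm_formC.
have herm_g x y : g x y = (-1) ^+ false * idfun (g y x) by rewrite mul1r.
have pos_g x : x != 0 -> 0 < g x x.
  by move=> x0; rewrite /g cm_formxx // exprn_gt0 // normr_gt0.
have bilin_g : bilinear_for *%R (idfun \; *%R) g.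
  split=> x; last exact: cm_form_linear.
  (* Symmetry carries linearity over from the second argument to the first. *)
  by move=> a y z; rewrite /= ![g _ x]gC; exact: cm_form_linear.
pose ip : {dot X for (@idfun R)} := HB.pack g
  (bilinear_isBilinear.Build R X X R *%R (idfun \; *%R) g bilin_g)
  (isHermitianSesquilinear.Build R X false idfun g herm_g)
  (isDotProduct.Build R X g pos_g).
by exists ip => x; rewrite /= /g cm_formxx // sqrtr_sqr normr_id.
Qed.
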